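(* For $p \in \mathbb{H}$ and $p^{\ast} \in \mathbb{R}^{3}$, we have $$p \in \ell(p^{\ast}) \quad \Longleftrightarrow \quad p^{\ast} \in \ell^{\ast}(p).$$
   Context: $\mathbb{H}$ denotes the Heisenberg group, whose underlying set is $\mathbb{R}^3$. For $y \in \mathbb{R}$ let $L_{y} = \mathrm{span}_{\mathbb{R}}(1,-y,y^2/2) \subset \mathbb{R}^3$. To a point $p = (x,y,t) \in \mathbb{H}$ associate the line (light ray) $$\ell^{\ast}(p) = (0,x,t - xy/2) + L_{y} \subset \mathbb{R}^3.$$ To a point $p^{\ast} = (a,b,c) \in \mathbb{R}^3$ associate the (horizontal) line $$\ell(p^{\ast}) = \{(as+b,s,\tfrac{b}{2}s + c) : s \in \mathbb{R}\} \subset \mathbb{H}.$$ *)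

(* Defs.v *)
From mathcomp Require Import all_boot all_order all_algebra.
From mathcomp Require Import all_classical all_reals.
Set Implicit Arguments.
Unset Strict Implicit.
Unset Printing Implicit Defensive.
Import Order.TTheory GRing.Theory Num.Theory.
Local Open Scope classical_set_scope.
Local Open Scope ring_scope.

Definition vec3 (R : realType) (a b c : R) : 'rV[R]_3 :=
  \row_(i < 3) [:: a; b; c]`_i.

(* Only the underlying set R^3 of the Heisenberg group is involved in the
   definitions below; the group law is not needed. *)
Definition heisenberg (R : realType) : Type := 'rV[R]_3.

Definition Hx (R : realType) (p : heisenberg R) : R := (p : 'rV[R]_3) 0 0.
Definition Hy (R : realType) (p : heisenberg R) : R := (p : 'rV[R]_3) 0 1.
Definition Ht (R : realType) (p : heisenberg R) : R := (p : 'rV[R]_3) 0 2%:R.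

Definition ray_dir (R : realType) (y : R) : {vspace 'rV[R]_3} :=
  <[vec3 1 (- y) (y ^+ 2 / 2)]>%VS.

Definition light_ray (R : realType) (p : heisenberg R) : set 'rV[R]_3 :=
  [set vec3 0 (Hx p) (Ht p - Hx p * Hy p / 2) + v
     | v in [set` ray_dir (Hy p)]].

Definition horizontal_line (R : realType) (q : 'rV[R]_3)
    : set (heisenberg R) :=
  let a := q 0 0 in let b := q 0 1 in let c := q 0 2%:R in
  [set (vec3 (a * s + b) s (b / 2 * s + c) : heisenberg R) | s in [set: R]].

(* Main.v *)
Require Import Defs.
From mathcomp Require Import all_boot all_order all_algebra.
From mathcomp Require Import all_classical all_reals.
From mathcomp Require Import ring.
Import Order.TTheory GRing.Theory Num.Theory.
Local Open Scope classical_set_scope.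
Local Open Scope ring_scope.

(** Both incidences amount to two scalar equations between p = (x, y, t) and
    p* = (a, b, c), because in each parametrization one coordinate reads off
    the parameter: the second coordinate of [horizontal_line p*] forces s = y,
    and the first coordinate of [light_ray p] forces the multiple of the
    direction (1, -y, y^2/2) to be a.  What remains is
      x = a y + b,  t = b y / 2 + c                  ([mem_horizontal_line])
      b = x - a y,  c = t - x y / 2 + a y^2 / 2      ([mem_light_ray]).
    The first equations of the two systems are equivalent, and substituting
    b = x - a y turns the second equation of one system into the other's. *)

Lemma eq_vec3 (R : realType) (u : 'rV[R]_3) (a b c : R) :
  u = vec3 a b c <-> [/\ u 0 0 = a, u 0 1 = b & u 0 2%:R = c].
Proof.
split=> [->|[ua ub uc]]; first by rewrite !mxE.
apply/rowP => i; rewrite mxE.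
case: i => [[|[|[|//]]]] lti3 /=.
- by rewrite -ua; congr (u _ _); apply: val_inj.
- by rewrite -ub; congr (u _ _); apply: val_inj.
- by rewrite -uc; congr (u _ _); apply: val_inj.
Qed.

Lemma vec3_line (R : realType) (a b c k a' b' c' : R) :
  vec3 a b c + k *: vec3 a' b' c' =
  vec3 (a + k * a') (b + k * b') (c + k * c').
Proof. by apply/eq_vec3; rewrite !mxE. Qed.

Lemma mem_horizontal_line (R : realType) (p : heisenberg R) (q : 'rV[R]_3) :
  p \in horizontal_line q <->
  Hx p = q 0 0 * Hy p + q 0 1 /\ Ht p = q 0 1 / 2 * Hy p + q 0 2%:R.
Proof.
rewrite inE; split=> [[s _ /esym/eq_vec3[xE yE tE]]|[xE tE]].
  by rewrite /Hx /Hy /Ht yE.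
by exists (Hy p) => //; apply/esym/eq_vec3.
Qed.

Lemma mem_light_ray (R : realType) (p : heisenberg R) (q : 'rV[R]_3) :
  q \in light_ray p <->
  q 0 1 = Hx p - q 0 0 * Hy p /\
  q 0 2%:R = Ht p - Hx p * Hy p / 2 + q 0 0 * (Hy p ^+ 2 / 2).
Proof.
rewrite inE; split=> [[v /= /vlineP[k ->]]|[bE cE]].
  rewrite vec3_line => /esym/eq_vec3[aE bE cE].
  move: aE; rewrite add0r mulr1 => aE.
  by rewrite bE cE aE mulrN.
exists (q 0 0 *: vec3 1 (- Hy p) (Hy p ^+ 2 / 2)).
  by apply/vlineP; exists (q 0 0).
by rewrite vec3_line; apply/esym/eq_vec3; rewrite add0r mulr1 mulrN.
Qed.

Theorem lemma4p11 (R : realType) (p : heisenberg R) (pstar : 'rV[R]_3) :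
  p \in horizontal_line pstar <-> pstar \in light_ray p.
Proof.
rewrite mem_horizontal_line mem_light_ray.
split=> [[xE tE]|[bE cE]].
- by rewrite tE xE; split; field.
- by rewrite cE bE; split; field.
Qed.
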